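(* Let $\mathcal{G}=(A,B,\mathbf{r},\mathbf{j},r_{\mathrm{ave}},j_{\mathrm{ave}})$ be a constrained bimatrix game with $A,B\in\mathbb{R}^{m\times n}$. If $r_{\mathrm{ave}}\ge\min_i r_i$ and $j_{\mathrm{ave}}\ge\min_k j_k$, then $\mathcal{G}$ has a Nash equilibrium.
   Context: A constrained bimatrix game $\mathcal{G}=(A,B,\mathbf{r},\mathbf{j},r_{\mathrm{ave}},j_{\mathrm{ave}})$ consists of payoff matrices $A,B\in\mathbb{R}^{m\times n}$ (for players I and II), vectors $\mathbf{r}=(r_1,\dots,r_m)^T$ with $0\le r_1<\dots<r_m$ and $\mathbf{j}=(j_1,\dots,j_n)^T$ with $0\le j_1<\dots<j_n$, and real numbers $r_{\mathrm{ave}},j_{\mathrm{ave}}$. It is assumed that $r_{\mathrm{ave}}<\max_i r_i$ or $j_{\mathrm{ave}}<\max_k j_k$. The feasible mixed strategies are $$\widehat{\mathbf{X}}=\{\mathbf{x}\in\mathbb{R}^m_+ : \textstyle\sum_i x_i=1,\ \mathbf{r}^T\mathbf{x}\le r_{\mathrm{ave}}\},\qquad \widehat{\mathbf{Y}}=\{\mathbf{y}\in\mathbb{R}^n_+ : \textstyle\sum_k y_k=1,\ \mathbf{j}^T\mathbf{y}\le j_{\mathrm{ave}}\}.$$ A pair $(\mathbf{x}^*,\mathbf{y}^* )$ is a Nash equilibrium (equilibrium pair) of $\mathcal{G}$ if $\mathbf{x}^*\in\widehat{\mathbf{X}}$, $\mathbf{y}^*\in\widehat{\mathbf{Y}}$,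 $\mathbf{x}^*$ maximizes $\mathbf{x}^TA\,\mathbf{y}^*$ over $\mathbf{x}\in\widehat{\mathbf{X}}$, and $\mathbf{y}^*$ maximizes ${\mathbf{x}^*}^TB\,\mathbf{y}$ over $\mathbf{y}\in\widehat{\mathbf{Y}}$. *)

(* Defs.v *)
From mathcomp Require Import all_boot all_order all_algebra.
From mathcomp Require Import classical_sets reals.

Set Implicit Arguments.
Unset Strict Implicit.
Unset Printing Implicit Defensive.

Import Order.TTheory GRing.Theory Num.Theory.

Local Open Scope classical_set_scope.
Local Open Scope ring_scope.

Section ColumnVectors.
Variables (R : realType) (p : nat).

(* The default value of each big operator is the first entry, so it is itself
   one of the entries ranged over and does not affect the result. *)
Definition min_entry (v : 'cV[R]_p.+1) : R :=
  \big[Num.min/v ord0 0]_(i < p.+1) v i 0.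

Definition max_entry (v : 'cV[R]_p.+1) : R :=
  \big[Num.max/v ord0 0]_(i < p.+1) v i 0.

Definition feasible_strategies (v : 'cV[R]_p.+1) (ave : R) :
    set 'cV[R]_p.+1 :=
  [set x : 'cV[R]_p.+1 | [/\ forall i, 0 <= x i 0,
               \sum_(i < p.+1) x i 0 = 1
             & (v^T *m x) 0 0 <= ave]].

End ColumnVectors.

(* The payoff matrices have m.+1 rows and n.+1 columns: the minima and maxima
   of the constraint vectors require both dimensions to be positive. *)
Record constrained_bimatrix_game (R : realType) (m n : nat) := ConstrainedGame {
  payoffI : 'M[R]_(m.+1, n.+1);
  payoffII : 'M[R]_(m.+1, n.+1);
  rvec : 'cV[R]_m.+1;
  jvec : 'cV[R]_n.+1;
  rave : R;
  jave : R;
  rvec_ge0 : 0 <= rvec ord0 0;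
  rvec_incr : forall i k : 'I_m.+1, (i < k)%N -> rvec i 0 < rvec k 0;
  jvec_ge0 : 0 <= jvec ord0 0;
  jvec_incr : forall i k : 'I_n.+1, (i < k)%N -> jvec i 0 < jvec k 0;
  ave_lt_max : rave < max_entry rvec \/ jave < max_entry jvec
}.

Section Equilibrium.
Variables (R : realType) (m n : nat) (G : constrained_bimatrix_game R m n).

Definition strategiesI : set 'cV[R]_m.+1 :=
  feasible_strategies (rvec G) (rave G).

Definition strategiesII : set 'cV[R]_n.+1 :=
  feasible_strategies (jvec G) (jave G).

Definition expected_payoff (M : 'M[R]_(m.+1, n.+1))
    (x : 'cV[R]_m.+1) (y : 'cV[R]_n.+1) : R :=
  (x^T *m M *m y) 0 0.

Definition nash_equilibrium (x : 'cV[R]_m.+1) (y : 'cV[R]_n.+1) : Prop :=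
  [/\ strategiesI x,
      strategiesII y,
      forall x', strategiesI x' ->
        expected_payoff (payoffI G) x' y <= expected_payoff (payoffI G) x y
    & forall y', strategiesII y' ->
        expected_payoff (payoffII G) x y' <= expected_payoff (payoffII G) x y].

End Equilibrium.

(* Main.v *)
(* Each strategy set is the convex hull of finitely many explicit points, so it
   suffices to find an equilibrium of the finite bimatrix game [a, b > 0] whose
   pure strategies are these points. Such an equilibrium is a normalized nonzero
   solution of the complementarity problem [z >= 0], [z C <= 1],
   [z_i (1 - z C)_i = 0], where [C] consists of the blocks [a] and [b] off the
   diagonal. This has the trivial solution [z = 0], and the number of its
   complementary lexicographically feasible bases is even (the Lemke-Howson
   parity argument), because by the ratio test every almost complementary choice
   of one row too many contains either no feasible basis or exactly two. *)
Require Import Defs.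
From mathcomp Require Import all_boot all_order all_algebra.
From mathcomp Require Import reals ring.

Set Implicit Arguments.
Unset Strict Implicit.
Unset Printing Implicit Defensive.

Import Order.TTheory GRing.Theory Num.Theory.
Local Open Scope ring_scope.

(** * Lexicographic positivity and lexicographically feasible bases *)

Definition lexpos (R : realFieldType) (n : nat) (v : 'cV[R]_n) : bool :=
  [exists k : 'I_n, (0 < v k 0) && [forall i : 'I_n, (i < k)%N ==> (v i 0 == 0)]].

Lemma lexposP (R : realFieldType) (n : nat) (v : 'cV[R]_n) :
  reflect (exists2 k : 'I_n, 0 < v k 0 & forall i : 'I_n, (i < k)%N -> v i 0 = 0)
          (lexpos v).
Proof.
apply: (iffP existsP) => [[k /andP[vk /forallP v0]]|[k vk v0]]; exists k => //.
  by move=> i lik; apply/eqP; move: (v0 i); rewrite lik.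
by rewrite vk /=; apply/forallP => i; apply/implyP => /v0 ->.
Qed.

Lemma lexpos0 (R : realFieldType) (n : nat) : lexpos (0 : 'cV[R]_n) = false.
Proof. by apply: negbTE; apply/negP => /lexposP[k]; rewrite mxE ltxx. Qed.

Lemma lexposD (R : realFieldType) (n : nat) (u v : 'cV[R]_n) :
  lexpos u -> lexpos v -> lexpos (u + v).
Proof.
move=> /lexposP[k uk u0] /lexposP[l vl v0]; apply/lexposP.
case: (ltngtP k l) => [lkl|llk|/val_inj ekl].
- exists k => [|i lik]; first by rewrite mxE (v0 k lkl) addr0.
  by rewrite mxE u0 // v0 ?addr0 // (ltn_trans lik).
- exists l => [|i lil]; first by rewrite mxE (u0 l llk) add0r.
  by rewrite mxE v0 // u0 ?addr0 // (ltn_trans lil).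
- subst l; exists k => [|i lik]; first by rewrite mxE addr_gt0.
  by rewrite mxE u0 // v0 // addr0.
Qed.

Lemma lexposZ (R : realFieldType) (n : nat) (a : R) (v : 'cV[R]_n) :
  0 < a -> lexpos (a *: v) = lexpos v.
Proof.
have impl b u : 0 < b -> lexpos u -> lexpos (b *: u : 'cV[R]_n).
  move=> b0 /lexposP[k uk u0]; apply/lexposP; exists k => [|i lik].
    by rewrite mxE mulr_gt0.
  by rewrite mxE u0 // mulr0.
move=> a0; apply/idP/idP => [|/impl->//].
move=> /(impl a^-1); rewrite invr_gt0 scalerA mulVf ?gt_eqF // scale1r.
exact.
Qed.

Lemma lexpos_total (R : realFieldType) (n : nat) (v : 'cV[R]_n) :
  v != 0 -> lexpos v || lexpos (- v).
Proof.
move=> vn0.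
have [i0 vi0] : exists i, v i 0 != 0.
  apply/existsP; apply: contraNT vn0; rewrite negb_exists => /forallP v0.
  apply/eqP/matrixP => i j; rewrite ord1 mxE; apply/eqP.
  by move: (v0 i); rewrite negbK.
case: (@arg_minnP _ i0 (fun i => v i 0 != 0) (@nat_of_ord n) vi0) => k vk kmin.
have v0 (i : 'I_n) : (i < k)%N -> v i 0 = 0.
  by move=> lik; apply/eqP; apply: contraTT lik => /kmin; rewrite -leqNgt.
case: (ltgtP (v k 0) 0) vk => // vk _.
- apply/orP; right; apply/lexposP; exists k => [|i /v0 vi0'].
    by rewrite mxE oppr_gt0.
  by rewrite mxE vi0' oppr0.
- by apply/orP; left; apply/lexposP; exists k.
Qed.

(** This discards the perturbation: entry [ord0] carries the unperturbed value. *)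
Lemma lexpos_ge0 (R : realFieldType) (n : nat) (v : 'cV[R]_n.+1) :
  lexpos v -> 0 <= v ord0 0.
Proof.
move=> /lexposP[k vk v0]; have [->|kn0] := eqVneq ord0 k; first exact: ltW.
by rewrite v0 // lt0n; apply: contra kn0 => /eqP k0; apply/eqP/val_inj.
Qed.

(* Lexicographic positivity of [col_mx 1 1%:M *m invmx Q] expresses positivity
   of the basic solution for the right-hand side perturbed by infinitesimals of
   decreasing order; its first row is the unperturbed basic solution. *)
Definition lexrhs (R : realFieldType) (n : nat) : 'M[R]_(1 + n, n) :=
  col_mx (const_mx 1) 1%:M.

Definition lexfeasible (R : realFieldType) (n : nat) (Q : 'M[R]_n) : bool :=
  (Q \in unitmx) && [forall i, lexpos (col i (lexrhs R n *m invmx Q))].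

(** Invertibility of [Q] comes for free: the lower block of [Z *m Q = lexrhs R n] exhibits a left
    inverse. *)
Lemma lexfeasibleP (R : realFieldType) (n : nat) (Q : 'M[R]_n) :
  reflect (exists2 Z : 'M_(1 + n, n), Z *m Q = lexrhs R n &
             forall i, lexpos (col i Z))
          (lexfeasible Q).
Proof.
apply: (iffP andP) => [[Qu /forallP Qpos]|[Z ZQ Zpos]].
  by exists (lexrhs R n *m invmx Q) => //; rewrite mulmxKV.
have Qu : Q \in unitmx.
  have : dsubmx Z *m Q = 1%:M.
    by rewrite mul_dsub_mx ZQ /lexrhs col_mxKd.
  by case/mulmx1_unit.
split=> //; apply/forallP => i.
by rewrite -ZQ mulmxK.
Qed.

Lemma mulmx_col'_row' (R : pzRingType) (p n q : nat) (j : 'I_n.+1)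
    (X : 'M[R]_(p, n.+1)) (M : 'M[R]_(n.+1, q)) :
  col j X = 0 -> col' j X *m row' j M = X *m M.
Proof.
move=> /colP Xj; apply/matrixP => a b; rewrite !mxE (bigD1_ord j) //=.
have := Xj a; rewrite !mxE => ->; rewrite mul0r add0r.
by apply: eq_bigr => i _; rewrite !mxE.
Qed.

(** Padding with a zero column places the solutions for all dropped rows in one affine space, where
    they can be compared. *)
Lemma lexfeasible_row'P (R : realFieldType) (n : nat) (M : 'M[R]_(n.+1, n))
    (j : 'I_n.+1) :
  reflect (exists X : 'M_(1 + n, n.+1), [/\ X *m M = lexrhs R n, col j X = 0 &
             forall i, i != j -> lexpos (col i X)])
          (lexfeasible (row' j M)).
Proof.
apply: (iffP (lexfeasibleP _)) => [[Z ZM Zpos]|[X [XM Xj Xpos]]]; last first.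
  exists (col' j X); first by rewrite mulmx_col'_row'.
  move=> i; have -> : col i (col' j X) = col (lift j i) X.
    by apply/colP => a; rewrite !mxE.
  by apply: Xpos; rewrite eq_sym neq_lift.
pose X : 'M[R]_(1 + n, n.+1) := \matrix_(a, i) oapp (Z a) 0 (unlift j i).
have Xj : col j X = 0 by apply/colP => a; rewrite !mxE unlift_none.
have XZ : col' j X = Z by apply/matrixP => a i; rewrite !mxE liftK.
exists X; split=> [|//|i].
  by rewrite -(mulmx_col'_row' _ Xj) XZ.
case: (unliftP j i) => [l ->|->]; last by rewrite eqxx.
by move=> _; have -> : col (lift j l) X = col l Z
  by apply/colP => a; rewrite !mxE liftK.
Qed.

(** * The ratio test and the parity of feasible bases *)

(** This is boundedness: the feasible polyhedron has no recession direction, so a pivot never runs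
    off to infinity. *)
Lemma nonneg_mulmx_eq0 (R : realFieldType) (p n : nat) (k : 'rV[R]_p)
    (M : 'M[R]_(p, n)) :
  (forall i j, 0 <= M i j) -> (forall i, exists j, 0 < M i j) ->
  (forall i, 0 <= k 0 i) -> k *m M = 0 -> k = 0.
Proof.
move=> M0 Mpos k0 kM; apply/rowP => i; rewrite mxE.
have [j Mij] := Mpos i.
have /eqP := congr1 (fun A : 'rV[R]_n => A 0 j) kM; rewrite !mxE.
rewrite psumr_eq0 => [/allP/(_ i)|l _]; last exact: mulr_ge0.
by rewrite mem_index_enum mulf_eq0 (gt_eqF Mij) orbF => /(_ isT)/eqP.
Qed.

(* The ratio test: the lexicographic perturbation rules out ties. *)
Lemma lexfeasible_pivot (R : realFieldType) (n : nat) (M : 'M[R]_(n.+1, n))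
    (j0 : 'I_n.+1) :
  (forall i j, 0 <= M i j) -> (forall i, exists j, 0 < M i j) ->
  lexfeasible (row' j0 M) ->
  exists2 j1, j1 != j0 &
    forall j, j != j0 -> lexfeasible (row' j M) = (j == j1).
Proof.
move=> M0 Mpos f0; have [X0 [X0M X0j X0pos]] := lexfeasible_row'P _ _ f0.
have Q0u : row' j0 M \in unitmx by case/andP: f0.
(* [k] is the linear dependency among the rows of [M], normalized to [1] at [j0]; it spans the left
   kernel because [row' j0 M] is invertible. *)
pose k : 'rV[R]_n.+1 := delta_mx 0 j0 - row j0 M *m dsubmx X0.
have dX M' (X : 'M[R]_(1 + n, n.+1)) : X *m M' = lexrhs R n ->
    dsubmx X *m M' = 1%:M.
  by move=> XM; rewrite mul_dsub_mx XM col_mxKd.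
have kM : k *m M = 0.
  by rewrite mulmxBl -mulmxA dX // mulmx1 -rowE subrr.
have kj0 : k 0 j0 = 1.
  rewrite !mxE !eqxx big1 ?subr0 // => l _.
  have /colP/(_ (rshift 1 l)) := X0j; rewrite !mxE => ->.
  by rewrite mulr0.
clearbody k.
have kerM p (V : 'M[R]_(p, n.+1)) : V *m M = 0 -> V = col j0 V *m k.
  move=> VM; apply/eqP; rewrite -subr_eq0; apply/eqP.
  set U := V - _.
  have UM : U *m M = 0 by rewrite mulmxBl -mulmxA kM mulmx0 VM subrr.
  have Uj : col j0 U = 0.
    by apply/colP => a; rewrite !mxE big_ord1 kj0 mulr1 mxE subrr.
  have U'0 : col' j0 U = 0.
    by rewrite -[LHS](mulmxK Q0u) (mulmx_col'_row' _ Uj) UM mul0mx.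
  apply/matrixP => a i; rewrite mxE; case: (unliftP j0 i) => [l|] ->.
    by have := congr1 (fun A : 'M[R]_(p,n) => A a l) U'0; rewrite !mxE.
  by have /colP/(_ a) := Uj; rewrite !mxE.
have colk y i : col i (X0 + y *m k) = col i X0 + k 0 i *: y.
  by apply/colP => a; rewrite !mxE big_ord1 mulrC.
have X0ge i : col i X0 = 0 \/ lexpos (col i X0).
  by have [->|/X0pos] := eqVneq i j0; [left|right].
(* By boundedness the dependency has a negative entry, so some row must block the move along [k]. *)
have [i0 ki0] : exists i, k 0 i < 0.
  apply/existsP; apply: contra_eqT kj0 => /existsPn kge0.
  have k0 : k = 0.
    by apply: (@nonneg_mulmx_eq0 _ _ _ _ M) => // i; rewrite leNgt kge0.
  by rewrite k0 mxE eq_sym oner_eq0.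
have kneg_j0 i : k 0 i < 0 -> i != j0.
  by apply: contraTneq => ->; rewrite kj0 -leNgt ler01.
pose ratio i := (- k 0 i)^-1 *: col i X0.
(* [ord u v] is the lexicographic order [u <= v]. *)
pose ord (u v : 'cV[R]_(1 + n)) := ~~ lexpos (u - v).
have ordP u v : ord u v -> u = v \/ lexpos (v - u).
  rewrite /ord => uv; have [/eqP|/lexpos_total] := eqVneq (u - v) 0.
    by rewrite subr_eq0 => /eqP; left.
  by rewrite (negPf uv) opprB; right.
have ord_refl : reflexive ord by move=> u; rewrite /ord subrr lexpos0.
have ord_anti (u v : 'cV[R]_(1 + n)) : lexpos (u - v) -> lexpos (v - u) -> False.
  by move=> p1 p2; have := lexposD p1 p2; rewrite addrC subrKA subrr lexpos0.
have ord_trans : transitive ord.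
  move=> v u w uv vw; apply/negP => pos.
  case: (ordP _ _ uv) => [euv|luv]; first by rewrite /ord -euv pos in vw.
  case: (ordP _ _ vw) => [evw|lvw]; first by rewrite /ord evw pos in uv.
  have := lexposD luv lvw; rewrite addrC subrKA => lwu; exact: ord_anti lwu pos.
have ord_total : total ord.
  move=> u v; rewrite /ord -negb_and; apply/negP => /andP[a b].
  exact: ord_anti a b.
case: (@extremumP _ _ ord i0 (fun i => k 0 i < 0) ratio ord_refl ord_trans
  ord_total ki0) => j1 kj1 jmin.
have ratioE i y : k 0 i < 0 ->
    lexpos (col i X0 + k 0 i *: y) = lexpos (ratio i - y).
  move=> ki; have ki' : 0 < - k 0 i by rewrite oppr_gt0.
  rewrite -(lexposZ (ratio i - y) ki') /ratio scalerBr scalerA mulfV ?gt_eqF //.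
  by rewrite scale1r scaleNr opprK.
have ratio0 i y : k 0 i < 0 -> col i X0 + k 0 i *: y = 0 -> ratio i = y.
  move=> ki e; apply: (@scalerI _ _ (- k 0 i)); first by rewrite oppr_eq0 lt_eqF.
  rewrite /ratio scalerA mulfV ?oppr_eq0 ?lt_eqF // scale1r scaleNr.
  by apply/eqP; rewrite -addr_eq0 e.
have ratioK i : k 0 i < 0 -> col i X0 + k 0 i *: ratio i = 0.
  move=> ki; rewrite /ratio scalerA invrN mulrN mulfV ?lt_eqF //.
  by rewrite scaleN1r subrr.
have ratiopos i : k 0 i < 0 -> lexpos (ratio i).
  move=> ki; rewrite lexposZ ?invr_gt0 ?oppr_gt0 //.
  exact: X0pos (kneg_j0 _ ki).
exists j1; first exact: kneg_j0.
move=> j jj0; apply/lexfeasible_row'P/eqP => [[X [XM Xj Xpos]]|->].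
  (* A solution for another dropped row is [X0 + y *m k], with [y] the entering column. Its zero
     column forces [y = ratio j], and positivity at [j1] then contradicts minimality unless
     [j = j1]. *)
  have : (X - X0) *m M = 0 by rewrite mulmxBl XM X0M subrr.
  move=> /kerM; set y := col j0 _ => eX.
  have {eX}eX : X = X0 + y *m k by rewrite -eX addrC subrK.
  have ypos : lexpos y.
    have -> : y = col j0 X by rewrite eX colk X0j kj0 scale1r add0r.
    by apply: Xpos; rewrite eq_sym.
  have kj : k 0 j < 0.
    rewrite ltNge; apply/negP => kj.
    have := Xj; rewrite eX colk => Xj0.
    have := X0pos j jj0.
    have [k0|kn0] := eqVneq (k 0 j) 0.
      by move: Xj0; rewrite k0 scale0r addr0 => ->; rewrite lexpos0.
    move=> pj; have := lexposD pj; move/(_ (k 0 j *: y)).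
    by rewrite lexposZ ?lt0r ?kn0 // => /(_ ypos); rewrite Xj0 lexpos0.
  apply/eqP; apply: contraTT (jmin j kj) => jj1; rewrite negbK.
  have := Xpos j1; rewrite eq_sym jj1 => /(_ isT).
  rewrite eX colk ratioE //.
  by have := Xj; rewrite eX colk => /(ratio0 _ _ kj) ->.
pose y := ratio j1; pose X := X0 + y *m k.
have XM : X *m M = lexrhs R n by rewrite mulmxDl X0M -mulmxA kM mulmx0 addr0.
have Xcol i : col i X = col i X0 + k 0 i *: y by rewrite colk.
have Xj : col j1 X = 0 by rewrite Xcol ratioK.
exists X; split=> // i ij.
rewrite Xcol; case: (ltgtP (k 0 i) 0) => ki.
(* A tie would give [X] a second zero column, hence a zero column in the inverse of [row' j1 M]. *)
- rewrite ratioE //; have [e|//] := ordP _ _ (jmin i ki).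
  exfalso.
  have Xi : col i X = 0 by rewrite Xcol /y e ratioK.
  have : dsubmx (col' j1 X) *m row' j1 M = 1%:M.
    by rewrite mul_dsub_mx mulmx_col'_row' // XM col_mxKd.
  move=> /mulmx1C.
  case: (unliftP j1 i) ij => [l el _|->]; last by rewrite eqxx.
  move=> /(congr1 (fun A : 'M[R]_n => A l l)); rewrite !mxE eqxx big1 => [/eqP|a _].
    by rewrite eq_sym oner_eq0.
  have /colP/(_ (rshift 1 a)) := Xi; rewrite el !mxE => ->.
  by rewrite mulr0.
- case: (X0ge i) => [->|pi]; first by rewrite add0r lexposZ // ratiopos.
  by apply: lexposD => //; rewrite lexposZ // ratiopos.
- rewrite ki scale0r addr0; apply: X0pos.
  by apply: contra_eq_neq ki => ->; rewrite kj0 oner_eq0.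
Qed.

(** As soon as one basis is feasible, the ratio test yields exactly one other; the count is thus
    zero or two. *)
Lemma lexfeasible_parity (R : realFieldType) (n : nat) (M : 'M[R]_(n.+1, n)) :
  (forall i j, 0 <= M i j) -> (forall i, exists j, 0 < M i j) ->
  \big[addb/false]_j lexfeasible (row' j M) = false.
Proof.
move=> M0 Mpos.
have [[j0 f0]|nof] := altP (@existsP _ (fun j => lexfeasible (row' j M))).
  have [j1 j10 fE] := lexfeasible_pivot M0 Mpos f0.
  rewrite (bigD1 j0) //= (bigD1 j1) //= f0 fE // eqxx big1 // => j /andP[jj0 jj1].
  by rewrite fE // (negPf jj1).
rewrite big1 // => j _; apply: negbTE.
by move: nof; rewrite negb_exists => /forallP.
Qed.

(** * Complementary selections and their parity *)

Definition flip (I : finType) (i : I) (s : {ffun I -> bool}) : {ffun I -> bool} :=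
  [ffun j => s j (+) (j == i)].

Lemma flipK (I : finType) (i : I) : involutive (@flip I i).
Proof. by move=> s; apply/ffunP => j; rewrite !ffunE -addbA addbb addbF. Qed.

Lemma reindex_flip (I : finType) (i : I) (P : pred {ffun I -> bool})
    (F : {ffun I -> bool} -> bool) :
  \big[addb/false]_(s | P s) F s = \big[addb/false]_(s | P (flip i s)) F (flip i s).
Proof. by apply: reindex_inj; apply: inv_inj; apply: flipK. Qed.

(* A selection [s] picks, for each label [v], one of the rows [e_v] (slack) and
   [C_v]. Fixing a label [ord0], the bases inside a door are those obtained by
   dropping one row of [door s]; a basis missing label [lift ord0 v] lies in the
   two doors [s] and [flip (lift ord0 v) s]. *)
Definition selected_row (R : realFieldType) (n : nat) (C : 'M[R]_n) (b : bool)
    (v : 'I_n) : 'rV[R]_n :=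
  if b then row v C else delta_mx 0 v.

Definition selection (R : realFieldType) (n : nat) (C : 'M[R]_n)
    (s : {ffun 'I_n -> bool}) : 'M[R]_n :=
  \matrix_v selected_row C (s v) v.

Definition door (R : realFieldType) (n : nat) (C : 'M[R]_n.+1)
    (s : {ffun 'I_n.+1 -> bool}) : 'M[R]_(n.+2, n.+1) :=
  \matrix_i oapp (fun v => selected_row C (s v) v) (row ord0 C) (unlift ord0 i).

Lemma row'0_door (R : realFieldType) (n : nat) (C : 'M[R]_n.+1)
    (s : {ffun 'I_n.+1 -> bool}) :
  row' ord0 (door C s) = selection C s.
Proof. by apply/row_matrixP => v; rewrite rowK; apply/rowP => j; rewrite !mxE liftK. Qed.

(** When [s ord0] is false, the door contains both rows of label [ord0]: [C_0] at index 0 and [e_0]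
    at index 1. Dropping [e_0] leaves [C_0] as the choice for that label. *)
Lemma row'1_door (R : realFieldType) (n : nat) (C : 'M[R]_n.+1)
    (s : {ffun 'I_n.+1 -> bool}) :
  ~~ s ord0 -> row' (lift ord0 ord0) (door C s) = selection C (flip ord0 s).
Proof.
move=> s0; apply/row_matrixP => v; rewrite rowK; apply/rowP => j.
rewrite !mxE ffunE; case: (unliftP ord0 v) => [l|] ->.
  have -> : lift (lift ord0 ord0) (lift ord0 l) = lift ord0 (lift ord0 l) :> 'I_n.+2.
    exact/val_inj.
  by rewrite liftK /= eq_sym (negPf (neq_lift _ _)) addbF.
have -> : lift (lift ord0 ord0) ord0 = ord0 :> 'I_n.+2 by exact/val_inj.
by rewrite unlift_none (negPf s0) eqxx.
Qed.

Lemma row'_door_flip (R : realFieldType) (n : nat) (C : 'M[R]_n.+1)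
    (s : {ffun 'I_n.+1 -> bool}) (v : 'I_n.+1) :
  row' (lift ord0 v) (door C (flip v s)) = row' (lift ord0 v) (door C s).
Proof.
apply/row_matrixP => i; apply/rowP => j; rewrite !mxE.
case: (unliftP ord0 (lift (lift ord0 v) i)) => [l el|] //=.
rewrite ffunE; have -> : l == v = false; last by rewrite addbF.
apply/negbTE; apply: contraTneq isT => elv; subst l.
by have := neq_lift (lift ord0 v) i; rewrite el eqxx.
Qed.

(** Double counting over the doors with [s ord0] false: every door contributes an even number of
    feasible bases, and those missing a label other than [ord0] are counted twice. The remaining
    ones are the complementary bases, each counted once. *)
Lemma selection_parity (R : realFieldType) (n : nat) (C : 'M[R]_n.+1) :
  (forall i j, 0 <= C i j) -> (forall i, exists j, 0 < C i j) ->
  \big[addb/false]_s lexfeasible (selection C s) = false.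
Proof.
move=> C0 Cpos.
pose f (s : {ffun 'I_n.+1 -> bool}) j := lexfeasible (row' j (door C s)).
have : \big[addb/false]_(s : {ffun 'I_n.+1 -> bool} | ~~ s ord0)
         \big[addb/false]_j f s j = false.
  rewrite big1 // => s _; apply: lexfeasible_parity => i.
    move=> j; rewrite mxE; case: (unlift ord0 i) => [v|] /=; last by rewrite mxE.
    by rewrite /selected_row; case: (s v); rewrite mxE // ler0n.
  case e: (unlift ord0 i) => [v|].
    case sv: (s v).
      by have [j Cj] := Cpos v; exists j; rewrite mxE e /= sv mxE.
    by exists v; rewrite mxE e /= sv mxE !eqxx ltr01.
  by have [j Cj] := Cpos ord0; exists j; rewrite mxE e /= mxE.
(* Indices 0 and 1 of the door, the two rows of label [ord0], are separated from the others. *)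
under [X in X = _ -> _]eq_bigr do rewrite big_ord_recl big_ord_recl.
rewrite !big_split /=.
have -> : \big[addb/false]_(s : {ffun 'I_n.+1 -> bool} | ~~ s ord0)
            \big[addb/false]_(v < n) f s (lift ord0 (lift ord0 v)) = false.
  rewrite exchange_big big1 // => v _.
  set w := lift ord0 v.
  rewrite (bigID (fun s : {ffun 'I_n.+1 -> bool} => s w)) /=.
  rewrite [X in _ (+) X](reindex_flip w) /=.
  under [X in _ (+) X]eq_big.
  - by move=> s; rewrite !ffunE eqxx addbT negbK (negbTE (neq_lift ord0 v)) addbF; over.
  - by move=> s _; rewrite /f row'_door_flip; over.
  by rewrite addbb.
(* Dropping row 0 yields the selections with [s ord0] false, dropping row 1 those with [s ord0]
   true. *)
rewrite addbF => parity; rewrite -[RHS]parity.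
rewrite (bigID (fun s : {ffun 'I_n.+1 -> bool} => ~~ s ord0)) /=; congr (_ (+) _).
  by apply: eq_bigr => s _; rewrite /f row'0_door.
rewrite (reindex_flip ord0); apply: eq_big => [s|s].
  by rewrite ffunE eqxx addbT negbK.
by rewrite !ffunE eqxx addbT !negbK => s0; rewrite /f row'1_door.
Qed.

(** * Nontrivial solutions of the complementarity problem *)

(** The all-slack basis [s0] is feasible and gives [z = 0]; by parity there is a second feasible
    complementary basis, and [z] is read off from it. *)
Lemma complementary_solution_ord (R : realFieldType) (n : nat) (C : 'M[R]_n.+1) :
  (forall i j, 0 <= C i j) -> (forall i, exists j, 0 < C i j) ->
  exists z : 'rV[R]_n.+1, [/\ z != 0, forall i, 0 <= z 0 i,
    forall i, (z *m C) 0 i <= 1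
    & forall i, z 0 i != 0 -> (z *m C) 0 i = 1].
Proof.
move=> C0 Cpos.
pose s0 : {ffun 'I_n.+1 -> bool} := [ffun=> false].
have fs0 : lexfeasible (selection C s0).
  apply/lexfeasibleP; exists (lexrhs R n.+1).
    have -> : selection C s0 = 1%:M.
      apply/row_matrixP => v; rewrite rowK ffunE /selected_row.
      by apply/rowP => j; rewrite !mxE eqxx eq_sym.
    exact: mulmx1.
  move=> i; apply/lexposP; exists ord0 => //.
  have -> : ord0 = lshift n.+1 ord0 :> 'I_(1 + n.+1) by exact/val_inj.
  by rewrite mxE col_mxEu mxE ltr01.
have [s ss0 fs] : exists2 s, s != s0 & lexfeasible (selection C s).
  apply/exists_inP; have := selection_parity C0 Cpos.
  apply: contra_eqT => /exists_inPn nof.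
  by rewrite (bigD1 s0) //= fs0 big1 // => s /nof /negbTE.
have [Z ZQ Zpos] := lexfeasibleP _ fs.
pose a := usubmx Z.
have a0 i : 0 <= a 0 i.
  have := lexpos_ge0 (Zpos i); rewrite !mxE.
  by congr (_ <= Z _ _); exact/val_inj.
have aQ : a *m selection C s = const_mx 1.
  by rewrite mul_usub_mx ZQ col_mxKu.
clearbody a.
pose z : 'rV[R]_n.+1 := \row_v (if s v then a 0 v else 0).
(* The slack of constraint [i] is the coefficient of [e_i], hence zero when [C_i] is selected. As
   [s] differs from [s0], some constraint is tight, which makes [z] nonzero. *)
have aE i : (z *m C) 0 i + (if s i then 0 else a 0 i) = 1.
  have <- : (a *m selection C s) 0 i = 1 by rewrite aQ mxE.
  rewrite ![(_ *m _) 0 i]mxE.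
  rewrite [RHS](bigID (fun v => s v)) /=; congr (_ + _).
    rewrite [RHS]big_mkcond; apply: eq_bigr => v _.
    by rewrite [selection _ _ _ _]mxE [z _ _]mxE; case: (s v); rewrite ?mul0r // mxE.
  case: ifPn => si.
    rewrite big1 // => v sv; rewrite [selection _ _ _ _]mxE (negPf sv) mxE eqxx.
    by case: eqVneq sv => [<-|]; rewrite ?si // mulr0.
  rewrite (bigD1 i) //= [selection _ _ _ _]mxE (negPf si) mxE !eqxx mulr1 big1 ?addr0 // => v.
  case/andP=> sv iv; rewrite [selection _ _ _ _]mxE (negPf sv) mxE eqxx eq_sym (negPf iv).
  by rewrite mulr0.
exists z; split=> [|i|i|i].
- have [v sv] : exists v, s v.
    apply/existsP; apply: contraNT ss0 => /existsPn sv.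
    by apply/eqP/ffunP => v; rewrite ffunE; apply: negbTE.
  apply: contra_eqN (aE v) => /eqP ->.
  by rewrite mul0mx mxE sv addr0 eq_sym oner_eq0.
- by rewrite mxE; case: ifP.
- by rewrite -(aE i) lerDl; case: ifP.
- by rewrite [z 0 i]mxE -(aE i); case: ifP; rewrite ?eqxx // addr0.
Qed.

Lemma complementary_solution (R : realFieldType) (V : finType) (c : V -> V -> R) (v0 : V) :
  (forall u v, 0 <= c u v) -> (forall u, exists v, 0 < c u v) ->
  exists z : V -> R, [/\ exists v, z v != 0, forall v, 0 <= z v,
    forall v, \sum_u z u * c u v <= 1
    & forall v, z v != 0 -> \sum_u z u * c u v = 1].
Proof.
move=> c0 cpos; case e: #|V| => [|n].
  by have := max_card (pred1 v0); rewrite card1 e.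
pose g (i : 'I_n.+1) : V := enum_val (cast_ord (esym e) i).
pose h (v : V) : 'I_n.+1 := cast_ord e (enum_rank v).
have gK : cancel g h by move=> i; rewrite /g /h enum_valK cast_ordKV.
have hK : cancel h g by move=> v; rewrite /g /h cast_ordK enum_rankK.
pose C : 'M[R]_n.+1 := \matrix_(i, j) c (g i) (g j).
have [|i|z [zn0 z0 zle zeq]] := @complementary_solution_ord _ _ C.
- by move=> i j; rewrite mxE.
- by have [v cv] := cpos (g i); exists (h v); rewrite mxE hK.
have sumE v : \sum_u z 0 (h u) * c u v = (z *m C) 0 (h v).
  rewrite mxE (reindex g) /=; last by exists h => ? _; rewrite ?gK ?hK.
  by apply: eq_bigr => i _; rewrite mxE gK hK.
exists (fun v => z 0 (h v)); split=> [|//|v|v]; rewrite ?sumE //; last exact: zeq.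
have /existsP[i zi] : [exists i, z 0 i != 0].
  apply: contraNT zn0 => /existsPn zi; apply/eqP/rowP => i; rewrite mxE.
  by apply/eqP; move: (zi i); rewrite negbK.
by exists (g i); rewrite gK.
Qed.

(** * Equilibria of finite bimatrix games *)

Definition is_mixed (R : realFieldType) (S : finType) (p : S -> R) : Prop :=
  (forall s, 0 <= p s) /\ \sum_s p s = 1.

Lemma psumr_gt0 (R : realFieldType) (S : finType) (p : S -> R) :
  (forall s, 0 <= p s) -> (exists s, p s != 0) -> 0 < \sum_s p s.
Proof.
move=> p0 [s ps]; rewrite (bigD1 s) //= ltr_wpDr ?sumr_ge0 // lt0r ps.
exact: p0.
Qed.

(** Complementarity says that a pure strategy in use attains the maximal payoff [1]; dividing each
    half of [z] by its sum gives mixed strategies. *)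
Lemma nash_pos (R : realFieldType) (S T : finType) (a b : S -> T -> R) (s0 : S) (t0 : T) :
  (forall s t, 0 < a s t) -> (forall s t, 0 < b s t) ->
  exists (p : S -> R) (q : T -> R), [/\ is_mixed p, is_mixed q,
    forall s, \sum_t q t * a s t <= \sum_s' p s' * \sum_t q t * a s' t
    & forall t, \sum_s p s * b s t <= \sum_t' q t' * \sum_s p s * b s t'].
Proof.
move=> apos bpos.
pose c (u v : S + T) : R := match u, v with
  | inl s, inr t => b s t | inr t, inl s => a s t | _, _ => 0 end.
have [||z [[v zv] z0 zle zeq]] := @complementary_solution _ _ c (inl s0).
- by move=> [s|t] [s'|t'] //=; apply: ltW.
- by move=> [s|t]; [exists (inr t0); apply: bpos|exists (inl s0); apply: apos].
pose x s := z (inl s); pose y t := z (inr t).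
have sumL s : \sum_u z u * c u (inl s) = \sum_t y t * a s t.
  rewrite big_sumType /= big1 ?add0r // => s' _; exact: mulr0.
have sumR t : \sum_u z u * c u (inr t) = \sum_s x s * b s t.
  rewrite big_sumType /= [X in _ + X]big1 ?addr0 // => t' _; exact: mulr0.
have yle s : \sum_t y t * a s t <= 1 by rewrite -sumL.
have xle t : \sum_s x s * b s t <= 1 by rewrite -sumR.
have yeq s : x s != 0 -> \sum_t y t * a s t = 1 by rewrite -sumL; apply: zeq.
have xeq t : y t != 0 -> \sum_s x s * b s t = 1 by rewrite -sumR; apply: zeq.
have nz (I : finType) (p f : I -> R) : \sum_i p i * f i = 1 -> exists i, p i != 0.
  move=> e; apply/existsP; apply: contra_eqT e => /existsPn p0.
  rewrite big1 => [|i _]; first by rewrite eq_sym oner_eq0.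
  by move: (p0 i); rewrite negbK => /eqP ->; rewrite mul0r.
(* One half of [z] is nonzero; tightness of the constraint at an index in its support makes the
   other half nonzero. *)
have [xn yn] : (exists s, x s != 0) /\ (exists t, y t != 0).
  case: v zv => [s|t] zv.
    by split; [exists s|apply: nz (yeq _ zv)].
  by split; [apply: nz (xeq _ zv)|exists t].
have x0 s : 0 <= x s by apply: z0.
have y0 t : 0 <= y t by apply: z0.
have X0 := psumr_gt0 x0 xn; have Y0 := psumr_gt0 y0 yn.
set X := \sum_s x s in X0; set Y := \sum_t y t in Y0.
have norm (I : finType) (p : I -> R) : (forall i, 0 <= p i) -> 0 < \sum_i p i ->
    is_mixed (fun i => p i / \sum_i p i).
  move=> p0 pp; split=> [i|]; first by rewrite divr_ge0 // ltW.
  by rewrite -mulr_suml mulfV // gt_eqF.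
(* After normalization every pure reply earns at most [1 / \sum_j q j], with equality on the support
   of [p], so the mixture earns exactly this value. *)
have best (I J : finType) (p : I -> R) (q : J -> R) (d : I -> J -> R) i :
    (forall i, 0 <= p i) -> 0 < \sum_i p i -> 0 < \sum_j q j ->
    (forall i, \sum_j q j * d i j <= 1) ->
    (forall i, p i != 0 -> \sum_j q j * d i j = 1) ->
    \sum_j q j / (\sum_j q j) * d i j <=
    \sum_i' p i' / (\sum_i p i) * \sum_j q j / (\sum_j q j) * d i' j.
  move=> p0 pp qp le1 eq1.
  have pull i' : \sum_j q j / (\sum_j q j) * d i' j =
      (\sum_j q j * d i' j) / \sum_j q j.
    by rewrite mulr_suml; apply: eq_bigr => j _; rewrite mulrAC.
  have -> : \sum_i' p i' / (\sum_i p i) * (\sum_j q j / (\sum_j q j) * d i' j) =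
      \sum_i' p i' / (\sum_i p i) / \sum_j q j.
    apply: eq_bigr => i' _; rewrite pull; have [->|pi] := eqVneq (p i') 0; first by rewrite !mul0r.
    by rewrite eq1 // mul1r.
  rewrite pull -!mulr_suml mulfV ?gt_eqF //.
  by rewrite ler_pM2r ?invr_gt0.
exists (fun s => x s / X), (fun t => y t / Y); split; try exact: norm.
- by move=> s; apply: best.
- by move=> t; apply: (@best T S y x (fun t s => b s t)).
Qed.

(** Adding a constant to all payoffs shifts both sides of a best-reply inequality equally, which
    reduces to positive payoffs. *)
Lemma nash_exists (R : realFieldType) (S T : finType) (a b : S -> T -> R) (s0 : S) (t0 : T) :
  exists (p : S -> R) (q : T -> R), [/\ is_mixed p, is_mixed q,
    forall s, \sum_t q t * a s t <= \sum_s' p s' * \sum_t q t * a s' t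
    & forall t, \sum_s p s * b s t <= \sum_t' q t' * \sum_s p s * b s t'].
Proof.
pose c (f : S -> T -> R) := 1 + \sum_s \sum_t `|f s t|.
have cpos (f : S -> T -> R) s t : 0 < f s t + c f.
  have -> : f s t + c f = 1 + (f s t + \sum_s \sum_t `|f s t|) by rewrite addrCA.
  apply: ltr_wpDr => //; rewrite addrC -[f s t]opprK subr_ge0.
  rewrite (bigD1 s) //= (bigD1 t) //= -addrA ler_wpDr //.
    by rewrite addr_ge0 // sumr_ge0 // => *; rewrite ?sumr_ge0.
  by rewrite -normrN ler_norm.
have shift (I : finType) (p f : I -> R) d : is_mixed p ->
    \sum_i p i * (f i + d) = \sum_i p i * f i + d.
  move=> [_ p1]; under eq_bigr do rewrite mulrDr.
  by rewrite big_split /= -mulr_suml p1 mul1r.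
have shift2 (I J : finType) (p : I -> R) (q : J -> R) f d : is_mixed p -> is_mixed q ->
    \sum_i p i * \sum_j q j * (f i j + d) = \sum_i p i * \sum_j q j * f i j + d.
  by move=> mp mq; rewrite -shift //; apply: eq_bigr => i _; rewrite shift.
have [p [q [mp mq pbest qbest]]] := nash_pos s0 t0 (cpos a) (cpos b).
exists p, q; split=> // [s|t].
  by have := pbest s; rewrite shift // shift2 // lerD2r.
by have := qbest t; rewrite shift // (shift2 _ _ q p (fun t s => b s t)) // lerD2r.
Qed.

(** * The feasible strategies as a convex hull of finitely many points *)

Section FeasibleHull.
Variables (R : realType) (n : nat) (v : 'cV[R]_n.+1) (ave : R).
Implicit Types x : 'cV[R]_n.+1.

Lemma min_entry_attained : exists i, min_entry v = v i 0.
Proof.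
rewrite /min_entry; elim/big_ind: _ => [|a b [i ->] [j ->]|i _].
- by exists ord0.
- by case: (leP (v i 0) (v j 0)) => _; [exists i|exists j].
- by exists i.
Qed.

(** As a linear functional, the sum of entries falls under [mulmx_combination] just like the
    constraint. *)
Lemma sum_entriesE x : \sum_i x i 0 = ((const_mx 1 : 'rV_n.+1) *m x) 0 0.
Proof. by rewrite mxE; apply: eq_bigr => i _; rewrite mxE mul1r. Qed.

Lemma mulmx_delta_cV (u : 'rV[R]_n.+1) i : (u *m (delta_mx i 0 : 'cV_n.+1)) 0 0 = u 0 i.
Proof. by rewrite -colE mxE. Qed.

Lemma mulmx_combination (S : finType) (w : S -> R) (pt : S -> 'cV[R]_n.+1)
    (u : 'rV[R]_n.+1) :
  (u *m \sum_s w s *: pt s) 0 0 = \sum_s w s * (u *m pt s) 0 0.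
Proof.
by rewrite mulmx_sumr summxE; apply: eq_bigr => s _; rewrite -scalemxAr mxE.
Qed.

Lemma feasible_convex (S : finType) (w : S -> R) (pt : S -> 'cV[R]_n.+1) :
  is_mixed w -> (forall s, feasible_strategies v ave (pt s)) ->
  feasible_strategies v ave (\sum_s w s *: pt s).
Proof.
move=> [w0 w1] fpt; split=> [i||].
- rewrite summxE sumr_ge0 // => s _; rewrite mxE mulr_ge0 //.
  by have [] := fpt s.
- rewrite sum_entriesE mulmx_combination -[RHS]w1; apply: eq_bigr => s _.
  by rewrite -sum_entriesE; have [_ -> _] := fpt s; rewrite mulr1.
- rewrite mulmx_combination -[leRHS]mul1r -w1 mulr_suml ler_sum // => s _.
  by rewrite ler_wpM2l //; have [] := fpt s.
Qed.

(* The vertices are the admissible unit vectors and the points where the edge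
   from an admissible to an inadmissible unit vector leaves the half-space. *)
Definition vertex (i0 : 'I_n.+1) (s : 'I_n.+1 * 'I_n.+1) : 'cV[R]_n.+1 :=
  let: (i, k) := s in
  if v i 0 <= ave then
    if v k 0 <= ave then delta_mx i 0
    else ((v k 0 - ave) / (v k 0 - v i 0)) *: delta_mx i 0
         + ((ave - v i 0) / (v k 0 - v i 0)) *: delta_mx k 0
  else delta_mx i0 0.

Lemma vertex_feasible i0 s :
  v i0 0 <= ave -> feasible_strategies v ave (vertex i0 s).
Proof.
move=> vi0.
have dfeas i : v i 0 <= ave -> feasible_strategies v ave (delta_mx i 0).
  move=> vi; split=> [l||]; first by rewrite mxE ler0n.
    by rewrite sum_entriesE mulmx_delta_cV mxE.
  by rewrite mulmx_delta_cV mxE.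
case: s => i k /=; case: ifPn => [vi|_]; last exact: dfeas.
case: ifPn => [_|]; first exact: dfeas.
rewrite -ltNge => vk.
have vik : 0 < v k 0 - v i 0 by rewrite subr_gt0 (le_lt_trans vi).
have vk0 : 0 <= v k 0 - ave by rewrite subr_ge0 ltW.
have vi' : 0 <= ave - v i 0 by rewrite subr_ge0.
split=> [l||].
- by rewrite !mxE addr_ge0 // mulr_ge0 ?ler0n // divr_ge0 // ltW.
- rewrite sum_entriesE mulmxDr -!scalemxAr mxE mxE mulmx_delta_cV.
  rewrite [X in _ + X]mxE mulmx_delta_cV !mxE !mulr1 -mulrDl.
  by rewrite addrA subrK divff // gt_eqF.
- rewrite mulmxDr -!scalemxAr mxE mxE mulmx_delta_cV.
  rewrite [X in _ + X]mxE mulmx_delta_cV !mxE.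
  have vik' : v k 0 - v i 0 != 0 by rewrite gt_eqF.
  (* The constraint holds with equality at a crossing point. *)
  by rewrite le_eqVlt; apply/orP; left; apply/eqP; field.
Qed.

(* Each unit of excess [x k * (v k - ave)] is compensated by the slacks
   [x i * (ave - v i)], shared proportionally. If the total slack [S] is [0] then
   so is the total excess [D], and the junk value [D / S = 0] is the right one. *)
Lemma feasible_hull i0 x : v i0 0 <= ave -> feasible_strategies v ave x ->
  exists2 w, is_mixed w & x = \sum_s w s *: vertex i0 s.
Proof.
move=> vi0 [x0 x1 xv].
pose S := \sum_(i | v i 0 <= ave) x i 0 * (ave - v i 0).
pose D := \sum_(k | ~~ (v k 0 <= ave)) x k 0 * (v k 0 - ave).
(* [S - D] equals [ave] minus the constraint value of [x]. *)
have DS : D <= S.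
  rewrite -subr_ge0.
  have -> : S - D = \sum_i x i 0 * (ave - v i 0).
    rewrite (bigID (fun i => v i 0 <= ave)) /=; congr (_ + _).
    by rewrite -sumrN; apply: eq_bigr => i _; rewrite -mulrN opprB.
  under eq_bigr do rewrite mulrBr.
  rewrite sumrB -mulr_suml x1 mul1r subr_ge0; apply: le_trans xv.
  by rewrite mxE le_eqVlt; apply/orP; left; apply/eqP/eq_bigr => i _;
     rewrite mxE mulrC.
have S0 : 0 <= S by apply: sumr_ge0 => i vi; rewrite mulr_ge0 // subr_ge0.
have Dterm k : ~~ (v k 0 <= ave) -> 0 <= x k 0 * (v k 0 - ave).
  by rewrite -ltNge => vk; rewrite mulr_ge0 // subr_ge0 ltW.
(* For inadmissible [k], the pair [(i, k)] carries the share of [x k] assigned to [i]; [(i, i)]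
   carries what remains of [x i]. Pairs that [vertex] sends to the default [i0] get weight zero. *)
pose w (s : 'I_n.+1 * 'I_n.+1) : R := let: (i, k) := s in
  if v i 0 <= ave then
    if v k 0 <= ave then (if k == i then x i 0 * (1 - D / S) else 0)
    else x i 0 * x k 0 * (v k 0 - v i 0) / S
  else 0.
have w0 s : 0 <= w s.
  case: s => i k /=; case: ifPn => // vi; case: ifPn => [_|].
    case: ifP => // _; rewrite mulr_ge0 // subr_ge0.
    have [->|Sn0] := eqVneq S 0; first by rewrite invr0 mulr0.
    by rewrite ler_pdivrMr ?mul1r // lt0r Sn0.
  rewrite -ltNge => vk.
  by rewrite divr_ge0 // mulr_ge0 ?mulr_ge0 // subr_ge0 ltW // (le_lt_trans vi).
pose XH : 'cV[R]_n.+1 := \sum_(k | ~~ (v k 0 <= ave)) x k 0 *: delta_mx k 0.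
have rowsum i : v i 0 <= ave -> \sum_k w (i, k) *: vertex i0 (i, k) =
    x i 0 *: delta_mx i 0 + (x i 0 * (ave - v i 0) / S) *: XH.
  move=> vi; rewrite (bigID (fun k => v k 0 <= ave)) /=.
  rewrite (bigD1 i) //= vi eqxx [X in _ + X + _]big1 ?addr0; last first.
    by move=> k /andP[vk /negPf ki]; rewrite vk ki scale0r.
  have -> : \sum_(k | ~~ (v k 0 <= ave)) (if v k 0 <= ave
      then (if k == i then x i 0 * (1 - D / S) else 0)
      else x i 0 * x k 0 * (v k 0 - v i 0) / S) *:
      (if v k 0 <= ave then delta_mx i 0
       else ((v k 0 - ave) / (v k 0 - v i 0)) *: delta_mx i 0
         + ((ave - v i 0) / (v k 0 - v i 0)) *: delta_mx k 0) =
      \sum_(k | ~~ (v k 0 <= ave)) (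
        (x i 0 / S * (x k 0 * (v k 0 - ave))) *: delta_mx i 0
        + (x i 0 * (ave - v i 0) / S) *: (x k 0 *: (delta_mx k 0 : 'cV[R]_n.+1))).
    apply: eq_bigr => k vk; rewrite (negPf vk).
    have vik : v k 0 - v i 0 != 0.
      by rewrite subr_eq0; apply: contraNneq vk => ->.
    (* Generalizing [S^-1] spares [field] the condition that [S] is nonzero. *)
    by rewrite scalerDr !scalerA; congr (_ *: _ + _ *: _); move: S^-1 => t; field.
  rewrite big_split /= -scaler_sumr -scaler_suml -mulr_sumr addrA -scalerDl.
  congr (_ *: _ + _).
  by rewrite -/D mulrBr mulr1 mulrA mulrAC subrK.
have xE : x = \sum_s w s *: vertex i0 s.
  have -> : \sum_s w s *: vertex i0 s = \sum_i \sum_k w (i, k) *: vertex i0 (i, k).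
    by rewrite pair_bigA; apply: eq_bigr => -[].
  rewrite (bigID (fun i => v i 0 <= ave)) /= [X in _ + X]big1 ?addr0; last first.
    by move=> i /negPf vi; rewrite big1 // => k _; rewrite vi scale0r.
  rewrite (eq_bigr _ rowsum).
  rewrite big_split /= -scaler_suml -mulr_suml -/S.
  (* If [S = 0], then [D = 0] too, so [x] vanishes at all inadmissible indices and [XH = 0]. *)
  have -> : (S / S) *: XH = XH.
    have [Sz|Sn0] := eqVneq S 0; last by rewrite divff // scale1r.
    rewrite /XH big1 ?scaler0 // => k vk.
    have /eqP : D = 0.
      by apply/eqP; rewrite eq_le -{1}Sz DS sumr_ge0.
    rewrite psumr_eq0 // => /allP/(_ k); rewrite mem_index_enum vk => /(_ isT).
    rewrite mulf_eq0 subr_eq0 => /orP[/eqP->|/eqP e]; first by rewrite scale0r.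
    by rewrite e lexx in vk.
  rewrite /XH -(bigID (fun i => v i 0 <= ave) xpredT (fun i => x i 0 *: delta_mx i 0)) /=.
  rewrite {1}[x]matrix_sum_delta; apply: eq_bigr => i _.
  by rewrite big_ord1.
exists w; last exact: xE.
split=> //.
(* Each vertex has entry sum [1], so the total weight equals the entry sum of [x]. *)
have vsum s : \sum_i vertex i0 s i 0 = 1 by have [] := vertex_feasible s vi0.
rewrite -x1 xE sum_entriesE mulmx_combination; apply: eq_bigr => s _.
by rewrite -sum_entriesE vsum mulr1.
Qed.

End FeasibleHull.

(** * Transfer of the equilibrium to the constrained game *)

Theorem theorem6 (R : realType) (m n : nat)
    (G : constrained_bimatrix_game R m n)
    (hr : min_entry (rvec G) <= rave G)
    (hj : min_entry (jvec G) <= jave G) :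
  exists (x : 'cV[R]_m.+1) (y : 'cV[R]_n.+1), nash_equilibrium G x y.
Proof.
have [i0 ri0] := min_entry_attained (rvec G); rewrite {}ri0 in hr.
have [k0 jk0] := min_entry_attained (jvec G); rewrite {}jk0 in hj.
pose ptI := vertex (rvec G) (rave G) i0; pose ptII := vertex (jvec G) (jave G) k0.
pose pay M s t := expected_payoff M (ptI s) (ptII t).
have payE M p q : expected_payoff M (\sum_s p s *: ptI s) (\sum_t q t *: ptII t) =
    \sum_s p s * \sum_t q t * pay M s t.
  (* Transposing makes the payoff a linear functional of [x], so that [mulmx_combination] applies to
     either argument. *)
  have swapE x y : expected_payoff M x y = ((M *m y)^T *m x) 0 0.
    by rewrite /expected_payoff -mulmxA -[in LHS](trmxK (M *m y)) -trmx_mul mxE.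
  rewrite swapE mulmx_combination; apply: eq_bigr => s _; congr (_ * _).
  by rewrite -swapE /expected_payoff mulmx_combination.
have [p [q [mp mq pbest qbest]]] :=
  nash_exists (pay (payoffI G)) (pay (payoffII G)) (i0, i0) (k0, k0).
exists (\sum_s p s *: ptI s), (\sum_t q t *: ptII t); split.
- by apply: feasible_convex => // s; apply: vertex_feasible.
- by apply: feasible_convex => // t; apply: vertex_feasible.
(* A deviation is a mixture of vertices, so its payoff averages those of pure deviations. *)
- move=> x' /(feasible_hull hr)[w [w0 w1] ->]; rewrite !payE.
  rewrite -[leRHS]mul1r -w1 mulr_suml ler_sum // => s _.
  by rewrite ler_wpM2l.
- move=> y' /(feasible_hull hj)[w [w0 w1] ->]; rewrite !payE.
  have swap u : \sum_s p s * \sum_t u t * pay (payoffII G) s t =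
      \sum_t u t * \sum_s p s * pay (payoffII G) s t.
    under eq_bigr do rewrite mulr_sumr.
    rewrite exchange_big; apply: eq_bigr => t _; rewrite mulr_sumr.
    by apply: eq_bigr => s _; rewrite mulrCA.
  rewrite !swap -[leRHS]mul1r -w1 mulr_suml ler_sum // => t _.
  by rewrite ler_wpM2l.
Qed.
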